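(* Let $c\ge 1$ be an integer and let $\mathcal{H}=\{(H_1,U_1),\dots,(H_m,U_m)\}$ be a finite family, where each $H_i$ is a finite simple graph and $U_i\subseteq V(H_i)$. Then $\mathcal{H}$ is a $c$-closed polynomial pattern family.
   Context: A graph is $c$-closed if any two distinct non-adjacent vertices have fewer than $c$ common neighbours. Given a graph $H$ with $V(H)=\{1,\dots,k\}$ and $U\subseteq V(H)$, a $U$-clique prescribed blow-up of $H$ is a graph whose vertex set is partitioned into nonempty sets $V_1\sqcup\dots\sqcup V_k$ such that $V_i$ is complete to $V_j$ whenever $ij\in E(H)$, and $V_i$ is a clique for every $i\in U$. For a graph $G$ and $S\subseteq V(G)$, $G[S]$ is a maximal such blow-up if $G[S]$ is one and no $S'$ with $S\subsetneq S'\subseteq V(G)$ has $G[S']$ one. A family $\mathcal{H}=\{(H_i,U_i)\}$ is a $c$-closed polynomial pattern family if there is a polynomial $f\in\mathbb{R}[x]$ such that for every $c$-closed graph $G$ on $n$ vertices and every $(H_i,U_i)\in\mathcal{H}$, the number of sets $S\subseteq V(G)$ with $G[S]$ a maximal $U_i$-clique prescribed blow-up of $H_i$ is at most $f(n)$. *)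

(* Defs.v *)
From HB Require Import structures.
From mathcomp Require Import all_boot all_order all_algebra.
From mathcomp Require Import reals.

Set Implicit Arguments.
Unset Strict Implicit.
Unset Printing Implicit Defensive.

Import Order.TTheory GRing.Theory Num.Theory.

Local Open Scope ring_scope.

Record sgraph (T : finType) := SGraph {
  adj :> rel T;
  adj_sym : symmetric adj;
  adj_irr : irreflexive adj }.

Definition induced_adj (T : finType) (G : sgraph T) (S : {set T}) :
    rel {x : T | x \in S} :=
  fun x y => G (val x) (val y).

Lemma induced_sym (T : finType) (G : sgraph T) (S : {set T}) :
  symmetric (induced_adj G (S := S)).
Proof. by move=> x y; apply: adj_sym. Qed.

Lemma induced_irr (T : finType) (G : sgraph T) (S : {set T}) :
  irreflexive (induced_adj G (S := S)).
Proof. by move=> x; apply: adj_irr. Qed.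

Definition induced (T : finType) (G : sgraph T) (S : {set T}) :
    sgraph {x : T | x \in S} :=
  SGraph (@induced_sym T G S) (@induced_irr T G S).

Definition c_closed (c : nat) (T : finType) (G : sgraph T) : Prop :=
  forall x y : T, x != y -> ~~ G x y -> (#|[set z | G x z & G y z]| < c)%N.

Definition complete_to (T : finType) (G : sgraph T) (A B : {set T}) : bool :=
  [forall x in A, forall y in B, G x y].

Definition clique (T : finType) (G : sgraph T) (A : {set T}) : bool :=
  [forall x in A, forall y in A, (x != y) ==> G x y].

Record pattern := Pattern {
  porder : nat;
  pgraph : sgraph 'I_porder;
  pclique : {set 'I_porder} }.

(* No condition is imposed between V i and V j when ij is not an edge of the
   pattern, nor inside V i when i is outside the prescribed set. *)
Definition blowup (P : pattern) (T : finType) (G : sgraph T) : bool :=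
  [exists V : {ffun 'I_(porder P) -> {set T}},
    [&& [forall i, V i != set0],
        [forall i, forall j, (i != j) ==> [disjoint V i & V j]],
        \bigcup_i V i == [set: T],
        [forall i, forall j, pgraph P i j ==> complete_to G (V i) (V j)]
      & [forall i in pclique P, clique G (V i)]]].

Definition maximal_blowup (P : pattern) (T : finType) (G : sgraph T)
    (S : {set T}) : bool :=
  maxset (fun S' => blowup P (induced G S')) S.

Definition polynomial_pattern_family (R : realType) (c : nat) (I : Type)
    (H : I -> pattern) : Prop :=
  exists f : {poly R}, forall (T : finType) (G : sgraph T), c_closed c G ->
    forall i : I,
      #|[set S : {set T} | maximal_blowup (H i) G S]|%:R <= f.[#|T|%:R].

(* Main.v *)
Require Import Defs.
From mathcomp Require Import all_boot all_order all_algebra.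
From mathcomp Require Import reals.

(** Let [V_1, ..., V_k] be the parts of a maximal blow-up with vertex set [S].
    By [c]-closedness, if [V_i] is not a clique then each neighbouring part has
    fewer than [c] vertices, and the common neighbourhood [N(B)] of any set [B]
    of at least [c] vertices is a clique.  Let [B_i] be [V_i] if
    [#|V_i| < c], and a [c]-subset of [V_i] otherwise.  A small part is kept; a
    large one is replaced by the common neighbourhood of the small neighbouring
    parts, intersected with the clique [B_i :|: N(B_i)] when [V_i] is a clique.
    Adjacent large parts are cliques giving the same [B_i :|: N(B_i)], so the
    enlarged parts still form a blow-up, up to overlaps that can be removed.
    By maximality their union is [S]: thus [S] is determined by the [k] sets
    [B_i], of at most [c] vertices each, and [k] bits. *)

Set Implicit Arguments.
Unset Strict Implicit.
Unset Printing Implicit Defensive.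

Import Order.TTheory GRing.Theory Num.Theory.

(** * Blow-ups described inside the host graph *)

Lemma cliqueP (T : finType) (G : sgraph T) (A : {set T}) :
  reflect {in A &, forall x y, x != y -> G x y} (clique G A).
Proof.
apply: (iffP forall_inP) => [clA x y xA yA | clA x xA].
  by move/forall_inP: (clA x xA) => /(_ y yA) /implyP.
by apply/forall_inP => y yA; apply/implyP; apply: clA.
Qed.

Lemma complete_toP (T : finType) (G : sgraph T) (A B : {set T}) :
  reflect {in A & B, forall x y, G x y} (complete_to G A B).
Proof.
apply: (iffP forall_inP) => [cAB x y xA yB | cAB x xA].
  by move/forall_inP: (cAB x xA); apply.
by apply/forall_inP => y; apply: cAB.
Qed.

(** Covering is left out: the union of the parts is tracked separately, as it names the vertex set
    of the blow-up. *)
Record blowup_parts (P : pattern) (T : finType) (G : sgraph T)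
    (V : 'I_(porder P) -> {set T}) : Prop := BlowupParts {
  parts_neq0 : forall i, V i != set0;
  parts_disjoint : forall i j, i != j -> [disjoint V i & V j];
  parts_complete : forall i j, pgraph P i j -> complete_to G (V i) (V j);
  parts_clique : forall i, i \in pclique P -> clique G (V i) }.

Arguments blowup_parts P {T} G V.

(** Parts are carried along [val] between the subtype given by [S] and [T], so that blow-ups on
    different sets [S] can be compared in one type. *)
Lemma blowup_inducedP (P : pattern) (T : finType) (G : sgraph T)
    (S : {set T}) :
  reflect (exists2 V, blowup_parts P G V & \bigcup_i V i = S)
          (blowup P (induced G S)).
Proof.
apply: (iffP existsP) => [[V /and5P[V0 Vd VS Vc Vq]] | [V [V0 Vd Vc Vq] VS]].
  exists (fun i => val @: V i); first split.
  - move=> i; have /set0Pn[x xV] := forallP V0 i.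
    by apply/set0Pn; exists (val x); apply: imset_f.
  - move=> i j ij; move/forallP: Vd => /(_ i) /forallP /(_ j).
    rewrite ij /= => Vij; rewrite -setI_eq0 -imsetI; last first.
      by move=> x y _ _; apply: val_inj.
    by move: Vij; rewrite -setI_eq0 => /eqP ->; rewrite imset0.
  - move=> i j ij; move/forallP: Vc => /(_ i) /forallP /(_ j).
    rewrite ij => /complete_toP Vij; apply/complete_toP.
    by move=> _ _ /imsetP[x xV ->] /imsetP[y yV ->]; apply: (Vij x y).
  - move=> i iU; move/forall_inP: Vq => /(_ i iU) /cliqueP Vi.
    apply/cliqueP => _ _ /imsetP[x xV ->] /imsetP[y yV ->].
    by rewrite (inj_eq val_inj); apply: (Vi x y).
  apply/setP=> x; apply/bigcupP/idP => [[i _ /imsetP[y _ ->]] | xS].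
    exact: valP.
  have: Sub x xS \in \bigcup_i V i by rewrite (eqP VS) inE.
  by case/bigcupP=> i _ xV; exists i => //; apply/imsetP; exists (Sub x xS).
have VsubS i x : x \in V i -> x \in S.
  by move=> xV; rewrite -VS; apply/bigcupP; exists i.
exists [ffun i => [set x | val x \in V i]]; apply/and5P; split.
- apply/forallP => i; have /set0Pn[x xV] := V0 i; apply/set0Pn.
  by exists (Sub x (VsubS i x xV)); rewrite ffunE inE.
- apply/forallP => i; apply/forallP => j; apply/implyP => ij; rewrite !ffunE.
  rewrite -setI_eq0; apply/eqP/setP => x; rewrite !inE.
  by have [xV|//] := boolP (val x \in V i); rewrite (disjointFr (Vd i j ij) xV).
- apply/eqP/setP => x; rewrite [RHS]inE; apply/bigcupP.
  have: val x \in \bigcup_i V i by rewrite VS; apply: valP.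
  by case/bigcupP=> i _ xV; exists i => //; rewrite ffunE inE.
- apply/forallP => i; apply/forallP => j; apply/implyP => ij; rewrite !ffunE.
  apply/complete_toP => x y; rewrite !inE.
  by apply: (elimT (complete_toP _ _ _)); apply: Vc.
apply/forall_inP => i iU; rewrite ffunE; apply/cliqueP => x y; rewrite !inE.
rewrite -(inj_eq val_inj).
exact: (elimT (cliqueP _ _) (Vq i iU)).
Qed.

(** The sets [W i] may overlap. Vertices of the [V i] stay in place, and every other vertex is
    assigned to a single [W i] containing it; the resulting parts lie between [V i] and [W i]. *)
Lemma blowup_enlarge (P : pattern) (T : finType) (G : sgraph T)
    (V W : 'I_(porder P) -> {set T}) :
  blowup_parts P G V -> (forall i, V i \subset W i) ->
  (forall i j, pgraph P i j ->
     {in W i & W j, forall x y, x != y -> G x y}) ->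
  (forall i, i \in pclique P -> clique G (W i)) ->
  blowup P (induced G (\bigcup_i W i)).
Proof.
move=> [V0 Vd _ _] VW Wc Wq; apply/blowup_inducedP.
pose V' i := V i :|:
  [set x | (x \notin \bigcup_j V j) && ([pick j | x \in W j] == Some i)].
have V'W i : V' i \subset W i.
  rewrite subUset VW; apply/subsetP => x; rewrite inE => /andP[_].
  by case: pickP => // j xW /eqP[<-].
have V'd i j : i != j -> [disjoint V' i & V' j].
  move=> ij; rewrite -setI_eq0; apply/eqP/setP => x; rewrite !inE.
  have [xV | xV] /= := boolP (x \in \bigcup_j V j).
    rewrite !orbF; have [xVi | //] := boolP (x \in V i).
    by rewrite (disjointFr (Vd i j ij) xVi).
  have nV l : (x \in V l) = false.
    by apply: contraNF xV => xVl; apply/bigcupP; exists l.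
  rewrite !nV /=; case: eqP => //= ->.
  by apply: contraNF ij => /eqP[->].
exists V'; first split => //.
- move=> i; have /set0Pn[x xV] := V0 i.
  by apply/set0Pn; exists x; rewrite inE xV.
- move=> i j ij; apply/complete_toP => x y xi yj.
  apply: (Wc i j ij); [exact: (subsetP (V'W i)) | exact: (subsetP (V'W j)) |].
  (* Pattern edges join distinct indices, so disjointness of the new parts supplies the distinctness
     that [Wc] asks for. *)
  have nij : i != j by apply: contraTneq ij => ->; rewrite adj_irr.
  by apply: contraTneq yj => <-; rewrite (disjointFr (V'd i j nij) xi).
- move=> i iU; apply/cliqueP => x y xi yi.
  by apply: (elimT (cliqueP _ _) (Wq i iU)); apply: (subsetP (V'W i)).
apply/eqP; rewrite eqEsubset; apply/andP; split.
  by apply/bigcupsP => i _; apply: subset_trans (V'W i) _; apply: bigcup_sup.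
apply/subsetP => x /bigcupP[i _ xW].
have [/bigcupP[j _ xV] | xV] := boolP (x \in \bigcup_j V j).
  by apply/bigcupP; exists j; rewrite // inE xV.
case xE: [pick j | x \in W j] => [j |].
  by apply/bigcupP; exists j => //; rewrite !inE xV xE eqxx orbT.
by case: pickP xE => // /(_ i); rewrite xW.
Qed.

(** * Common neighbourhoods in c-closed graphs *)

Definition common_nbrs (T : finType) (G : sgraph T) (B : {set T}) : {set T} :=
  [set x | [forall y in B, G y x]].

Lemma common_nbrsP (T : finType) (G : sgraph T) (B : {set T}) (x : T) :
  reflect {in B, forall y, G y x} (x \in common_nbrs G B).
Proof. by rewrite inE; apply: forall_inP. Qed.

Section CClosed.

Variables (c : nat) (T : finType) (G : sgraph T).
Hypothesis Gc : c_closed c G.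

(** Otherwise all of [B] would consist of common neighbours of two non-adjacent vertices. *)
Lemma c_closed_adj (B : {set T}) (x y : T) :
  (c <= #|B|)%N -> x \in common_nbrs G B -> y \in common_nbrs G B ->
  x != y -> G x y.
Proof.
move=> cB /common_nbrsP xB /common_nbrsP yB xy; apply: contraT => nxy.
have := Gc xy nxy; rewrite ltnNge => /negP[].
apply: leq_trans cB _; apply/subset_leq_card/subsetP => z zB.
by rewrite inE ![G _ z]adj_sym xB ?yB.
Qed.

(** [A] lies in the common neighbourhood of the large set [B]. *)
Lemma complete_to_clique (A B : {set T}) :
  (c <= #|B|)%N -> complete_to G A B -> clique G A.
Proof.
move=> cB /complete_toP AB; apply/cliqueP => x y xA yA.
by apply: (c_closed_adj cB); apply/common_nbrsP => z zB; rewrite adj_sym AB.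
Qed.

(** For a clique [B] with at least [c] vertices, this is the unique maximal clique containing
    [B]. *)
Definition clique_hull (B : {set T}) : {set T} := B :|: common_nbrs G B.

Lemma clique_hull_clique (B : {set T}) :
  (c <= #|B|)%N -> clique G B -> clique G (clique_hull B).
Proof.
move=> cB /cliqueP clB; apply/cliqueP => x y /setUP[xB | xN] /setUP[yB | yN].
- exact: clB.
- by move=> _; move/common_nbrsP: yN; apply.
- by move=> _; rewrite adj_sym; move/common_nbrsP: xN; apply.
- exact: (c_closed_adj cB).
Qed.

Lemma sub_clique_hull (A B : {set T}) :
  B \subset A -> clique G A -> A \subset clique_hull B.
Proof.
move=> BA /cliqueP clA; apply/subsetP => x xA; rewrite inE.
have [//|xB] := boolP (x \in B); apply/common_nbrsP => y yB.
apply: clA => //; first exact: (subsetP BA).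
by apply: contraNneq xB => <-.
Qed.

(** The hull of [B] is a clique containing [A], hence lies in the hull of [A]. By symmetry, two
    large cliques complete to each other have the same hull. *)
Lemma clique_hull_sub (A B : {set T}) :
  (c <= #|B|)%N -> clique G B -> complete_to G A B ->
  clique_hull B \subset clique_hull A.
Proof.
move=> cB clB /complete_toP AB; apply: sub_clique_hull.
  apply/subsetP => x xA; rewrite inE; apply/orP; right.
  by apply/common_nbrsP => y yB; rewrite adj_sym AB.
exact: clique_hull_clique.
Qed.

(** * Enlarging the parts *)

Variable P : pattern.
Implicit Type (B : 'I_(porder P) -> {set T}) (b : 'I_(porder P) -> bool).

(** Only the sets [B] and the bits [b] enter, never the original parts; the count rests on this. The
    bit [b i] will record whether the original part is a clique. *)
Definition enlarged_part B b (i : 'I_(porder P)) : {set T} :=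
  if #|B i| < c then B i else
  [set x | [forall j, pgraph P i j && (#|B j| < c) ==>
                      (x \in common_nbrs G (B j))]]
  :&: (if b i then clique_hull (B i) else setT).

Lemma enlarged_part_small B b i x j y :
  pgraph P i j -> #|B j| < c -> c <= #|B i| ->
  x \in enlarged_part B b i -> y \in B j -> G y x.
Proof.
move=> ij sj bi; rewrite /enlarged_part ltnNge bi /= => /setIP[+ _] yB.
by rewrite inE => /forallP /(_ j); rewrite ij sj => /common_nbrsP; apply.
Qed.

Lemma blowup_enlarged (V B : 'I_(porder P) -> {set T}) :
  blowup_parts P G V ->
  (forall i, B i \subset V i) -> (forall i, #|B i| < c -> B i = V i) ->
  let W := enlarged_part B (fun i => clique G (V i)) in
  (forall i, V i \subset W i) /\ blowup P (induced G (\bigcup_i W i)).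
Proof.
move=> VP BV Bs W; have [V0 Vd Vc Vq] := VP.
have big i : c <= #|B i| -> c <= #|V i|.
  by move=> ci; apply: leq_trans ci (subset_leq_card (BV i)).
have clB i : clique G (V i) -> clique G (B i).
  move=> /cliqueP clV; apply/cliqueP => x y xB yB.
  by apply: clV; apply: (subsetP (BV i)).
have cB i j : pgraph P i j -> complete_to G (B i) (B j).
  move=> ij; apply/complete_toP => x y xB yB.
  by apply: (elimT (complete_toP _ _ _) (Vc i j ij)); apply: (subsetP (BV _)).
have VW i : V i \subset W i.
  rewrite /W /enlarged_part; case: ltnP => [/Bs -> // | ci].
  rewrite subsetI; apply/andP; split; last first.
    by case: ifP => [clV | _]; [apply: sub_clique_hull | apply: subsetT].
  (* A small neighbour [B j] is all of [V j], to which [V i] is complete. *)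
  apply/subsetP => x xV; rewrite inE; apply/forallP => j.
  apply/implyP => /andP[ij /Bs ->]; apply/common_nbrsP => y yV.
  rewrite adj_sym in ij.
  exact: (elimT (complete_toP _ _ _) (Vc j i ij)).
split=> //; apply: (blowup_enlarge VP VW).
- move=> i j ij x y xW yW xy; have ji : pgraph P j i by rewrite adj_sym.
  (* Small sets are unchanged and large ones were cut down to the common neighbours of their small
     neighbours, so only two large sets need the hulls. *)
  have [si | bi] := ltnP #|B i| c; have [sj | bj] := ltnP #|B j| c.
  + move: xW yW; rewrite /W /enlarged_part si sj.
    exact: (elimT (complete_toP _ _ _) (cB i j ij)).
  + move: xW; rewrite /W {1}/enlarged_part si.
    exact: (enlarged_part_small ji si bj yW).
  + move: yW; rewrite /W {1}/enlarged_part sj adj_sym.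
    exact: (enlarged_part_small ij sj bi xW).
  (* Two large adjacent parts force each other to be cliques, so both bits are set and both enlarged
     parts lie in the hull of [B i]. *)
  + have qi := complete_to_clique (big _ bj) (Vc i j ij).
    have qj := complete_to_clique (big _ bi) (Vc j i ji).
    move: xW yW; rewrite /W /enlarged_part !ltnNge bi bj qi qj /=.
    move=> /setIP[_ xW] /setIP[_ yW].
    apply: (elimT (cliqueP _ _) (clique_hull_clique bi (clB i qi))) => //.
    exact: (subsetP (clique_hull_sub bj (clB j qj) (cB i j ij))).
- move=> i /Vq qi; rewrite /W /enlarged_part; case: ltnP => [/Bs -> // | bi].
  apply/cliqueP => x y; rewrite qi => /setIP[_ xW] /setIP[_ yW].
  exact: (elimT (cliqueP _ _) (clique_hull_clique bi (clB i qi))).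
Qed.

End CClosed.

(** * Encoding and counting *)

(* The entries [None] pad the tuple when the set has fewer than [c] elements. *)
Definition tuple_set (c : nat) (T : finType) (t : c.-tuple (option T)) :
    {set T} :=
  [set x | Some x \in t].

(** Keep the first [c] elements of [A]; if fewer than [c] remain, nothing was cut off. *)
Lemma tuple_set_trunc (c : nat) (T : finType) (A : {set T}) :
  exists t : c.-tuple (option T),
    tuple_set t \subset A /\ (#|tuple_set t| < c -> tuple_set t = A).
Proof.
pose s := take c (enum A).
have ts : size (map Some s ++ nseq (c - size s) None) == c.
  by rewrite size_cat size_map size_nseq subnKC // size_take_min geq_minl.
have tE : tuple_set (Tuple ts) = [set x in s].
  apply/setP => x; rewrite !inE mem_cat mem_nseq andbF orbF.
  by rewrite mem_map // => y z [].
exists (Tuple ts); rewrite tE; split.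
  by apply/subsetP => x; rewrite inE => /mem_take; rewrite mem_enum.
rewrite cardsE (card_uniqP _) ?take_uniq ?enum_uniq // size_take_min.
rewrite gtn_min ltnn /= => /ltnW le_c.
by rewrite /s take_oversize //; apply/setP => x; rewrite inE mem_enum.
Qed.

(** It suffices that the image of [F] contains every maximal set. Per pattern vertex, a [c]-tuple
    over [option T] and one bit are chosen. *)
Lemma card_maximal_blowup (c : nat) (P : pattern) (T : finType)
    (G : sgraph T) :
  c_closed c G ->
  #|[set S | maximal_blowup P G S]| <= ((#|T|.+1 ^ c) * 2) ^ porder P.
Proof.
move=> Gc.
pose F (d : {ffun 'I_(porder P) -> c.-tuple (option T) * bool}) :=
  \bigcup_i enlarged_part c G (fun i => tuple_set (d i).1)
                               (fun i => (d i).2) i.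
have ->: ((#|T|.+1 ^ c) * 2) ^ porder P
         = #|{ffun 'I_(porder P) -> c.-tuple (option T) * bool}|.
  by rewrite card_ffun card_ord card_prod card_tuple card_option card_bool.
apply: leq_trans (leq_imset_card F _); apply/subset_leq_card/subsetP => S.
rewrite inE => /maxsetP[/blowup_inducedP[V VP VS] Smax].
have [t tP] := fin_all_exists (fun i => tuple_set_trunc c (V i)).
have [VW bW] := blowup_enlarged Gc VP (fun i => proj1 (tP i))
                                      (fun i => proj2 (tP i)).
apply/imsetP; exists [ffun i => (t i, clique G (V i))] => //.
have -> : F [ffun i => (t i, clique G (V i))] =
          \bigcup_i enlarged_part c G (fun i => tuple_set (t i))
                                      (fun i => clique G (V i)) i.
  apply: eq_bigr => i _; rewrite /enlarged_part !ffunE /=.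
  congr (if _ then _ else _ :&: _); apply/setP => x; rewrite !inE.
  by apply: eq_forallb => j; rewrite ffunE.
(* The union of the enlarged parts is a blow-up containing [S], so maximality gives equality. *)
apply/esym/Smax => //; rewrite -VS; apply/bigcupsP => i _.
by apply: subset_trans (VW i) _; apply: bigcup_sup.
Qed.

Local Open Scope ring_scope.

Theorem theorem4 (R : realType) (c m : nat) (hc : (1 <= c)%N)
    (H : 'I_m -> pattern) :
  polynomial_pattern_family R c H.
Proof.
(* Summing over the family gives one polynomial for all patterns, since every summand is nonnegative
   at [#|T|]. *)
exists (\sum_(i < m) ((('X + 1) ^+ c) * 2%:R) ^+ porder (H i)) => T G Gc i.
have evalE k : ((('X + 1) ^+ c * 2%:R) ^+ k : {poly R}).[#|T|%:R] =
               (((#|T|.+1 ^ c) * 2) ^ k)%:R.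
  by rewrite !hornerE natrX natrM natrX -natr1.
rewrite horner_sum (bigD1 i) //= evalE.
apply: le_trans (_ : (((#|T|.+1 ^ c) * 2) ^ porder (H i))%:R <= _).
  by rewrite ler_nat card_maximal_blowup.
by rewrite lerDl; apply: sumr_ge0 => j _; rewrite evalE ler0n.
Qed.
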